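(* For all $n\ge0$ we have $c(\omega^{(3)};2n+1)\equiv0\pmod2$ and $c(\omega^{(3)};2n)\equiv a_3(n)\pmod2$, where $a_3(n)$ is the number of $3$-core partitions of $n$. Moreover, $c(\omega^{(3)};2n)$ is odd if and only if $3n+1=k^2$ for some integer $k$. For every integer $N\ge0$, $$\#\{0\le n\le N:\ c(\omega^{(3)};2n)\equiv1\pmod2\}=\left\lfloor\sqrt{3N+1}\right\rfloor-\left\lfloor\frac{\sqrt{3N+1}}{3}\right\rfloor.$$
   Context: A $3$-core partition is a partition none of whose hook lengths is divisible by $3$; equivalently $\sum_{n\ge0}a_3(n)q^n=\frac{(q^3;q^3)_\infty^3}{(q;q)_\infty}$. $(a;q)_n=\prod_{k=0}^{n-1}(1-aq^k)$ and $(a;q)_\infty=\prod_{k\ge0}(1-aq^k)$. For a formal power series $g(q)=\sum_{n\ge0}c(n)q^n$, $c(g;n):=c(n)$. The third order mock theta function is $$\omega^{(3)}(q)=\sum_{n=0}^\infty\frac{q^{2n(n+1)}}{(q;q^2)_{n+1}^2}.$$ *)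

(* Defs.v *)
From mathcomp Require Import all_boot all_order all_algebra.
From mathcomp Require Import reals.

Set Implicit Arguments.
Unset Strict Implicit.
Unset Printing Implicit Defensive.

Import Order.TTheory GRing.Theory Num.Theory.
Local Open Scope ring_scope.

Section FormalPowerSeries.
Variable R : comUnitRingType.

(* [f n] is the coefficient of q^n. *)
Definition fps := nat -> R.

Definition fps_of_poly (p : {poly R}) : fps := fun n => p`_n.

Definition fps_mul (f g : fps) : fps :=
  fun n => \sum_(i < n.+1) f i * g (n - i)%N.

(* The first [n] coefficients of 1/f, obtained by solving (1/f) * f = 1
   degree by degree; meaningful when [f 0] is a unit, see [fps_mulVf]. *)
Fixpoint fps_inv_prefix (f : fps) (n : nat) : seq R :=
  if n is k.+1 then
    let s := fps_inv_prefix f k in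
    rcons s (((k == 0)%:R - \sum_(i < k) s`_i * f (k - i)%N) / f 0%N)
  else [::].

Definition fps_inv (f : fps) : fps := fun n => (fps_inv_prefix f n.+1)`_n.

(* Only the terms n <= m are used for the coefficient of q^m, so this is the
   sum of the series when [F n] is divisible by q^n, see [fps_sumE]. *)
Definition fps_sum (F : nat -> fps) : fps := fun m => \sum_(n < m.+1) F n m.

Lemma size_fps_inv_prefix f n : size (fps_inv_prefix f n) = n.
Proof. by elim: n => //= n IHn; rewrite size_rcons IHn. Qed.

Lemma nth_fps_inv_prefix f n i :
  (i < n)%N -> (fps_inv_prefix f n)`_i = fps_inv f i.
Proof.
elim: n => // n IHn; rewrite ltnS leq_eqVlt => /orP[/eqP->|lt_in] //.
by rewrite /= nth_rcons size_fps_inv_prefix lt_in IHn.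
Qed.

Lemma fps_mulVf f n : f 0%N \is a GRing.unit ->
  fps_mul (fps_inv f) f n = (n == 0)%:R.
Proof.
move=> f0U; rewrite /fps_mul big_ord_recr /= subnn.
rewrite {2}/fps_inv /= nth_rcons size_fps_inv_prefix ltnn eqxx divrK //.
under [X in _ - X]eq_bigr => i _ do rewrite nth_fps_inv_prefix //.
by rewrite addrC subrK.
Qed.

Lemma fps_sumE F : (forall n m, (m < n)%N -> F n m = 0) ->
  forall m N, (m < N)%N -> fps_sum F m = \sum_(n < N) F n m.
Proof.
move=> F0 m N lt_mN; rewrite /fps_sum (big_ord_widen N (fun n => F n m)) //.
rewrite [RHS](bigID (fun n : 'I_N => (n < m.+1)%N)) /= [X in _ + X]big1 ?addr0 //.
by move=> i; rewrite -leqNgt; apply: F0.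
Qed.

End FormalPowerSeries.

(* (a; q)_n *)
Definition qpoch (A : comNzRingType) (a q : A) (n : nat) : A :=
  \prod_(k < n) (1 - a * q ^+ k).

Definition omega3_term (n : nat) : fps int :=
  fps_mul (fps_of_poly 'X^(2 * n * n.+1))
          (fps_inv (fps_of_poly (qpoch 'X 'X^2 n.+1 ^+ 2))).

Definition omega3 : fps int := fps_sum omega3_term.

Lemma omega3_denom0 n :
  fps_of_poly (qpoch 'X 'X^2 n ^+ 2 : {poly int}) 0%N = 1.
Proof.
rewrite /fps_of_poly -horner_coef0 /qpoch horner_exp horner_prod.
rewrite big1 ?expr1n // => k _.
by rewrite !hornerE ?mul0r ?subr0.
Qed.

Lemma omega3_term_order n m : (m < n)%N -> omega3_term n m = 0.
Proof.
move=> lt_mn; rewrite /omega3_term /fps_mul big1 // => i _.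
rewrite /fps_of_poly coefXn ltn_eqF ?mul0r //.
apply: leq_ltn_trans (leq_ord i) (leq_trans lt_mn _).
by rewrite mulnAC leq_pmull ?muln_gt0.
Qed.

(* A partition is a weakly decreasing sequence [s] of naturals. Trailing zeros
   are allowed: they contribute no cell and change no hook length. Rows and
   columns are numbered from 0, and the cells are the (i, j) with j < s_i. *)
Definition hook_length (s : seq nat) (i j : nat) : nat :=
  let arm := (nth 0 s i - j.+1)%N in
  let leg := (count (fun r => j < r) s - i.+1)%N in
  (arm + leg).+1.

Definition is_core (t : nat) (s : seq nat) : bool :=
  [forall i : 'I_(size s), forall j : 'I_(nth 0 s i),
     ~~ (t %| hook_length s i j)]%N.

(* A partition of n has at most n nonzero parts, each at most n, so padding
   with zeros identifies it with a unique weakly decreasing n-tuple. *)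
Definition cores (t n : nat) : {set n.-tuple 'I_n.+1} :=
  [set p : n.-tuple 'I_n.+1 |
     let s := map (@nat_of_ord n.+1) p in
     [&& sorted geq s, sumn s == n & is_core t s]].

Definition a3 (n : nat) : nat := #|cores 3 n|.

(* Main.v *)
Require Import Defs.
From mathcomp Require Import all_boot all_order all_algebra.
From mathcomp Require Import reals.
From mathcomp Require Import zify ring.

Set Implicit Arguments.
Unset Strict Implicit.
Unset Printing Implicit Defensive.

Import Order.TTheory GRing.Theory Num.Theory.
Local Open Scope ring_scope.

(** Both the even coefficients of omega3 and the numbers a3 n are shown to have
    the parity of the indicator of the event that 3n + 1 is a square.

    For omega3, squaring is additive modulo 2, so (x; x^2)_{n+1}^2 becomes
    (q; q^2)_{n+1} with q = x^2. Hence omega3 is a series in x^2 modulo 2,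
    which settles the odd coefficients, and as signs are invisible modulo 2 it
    agrees with the left side of the identity of Rogers
      sum_n (-1)^n q^(n(n+1)) / (q; q^2)_{n+1}
        = sum_n (-1)^n q^(3n^2 + 2n) (1 + q^(2n+1)).
    The exponents e on the right, 3n^2 + 2n and 3n^2 + 4n + 1, are those for
    which 3e + 1 is (3n+1)^2 or (3n+2)^2, that is, any square; each occurs once
    (rogers_false_theta, omega3_mod2).

    For a3, conjugating partitions is an involution on the 3-cores of n, so
    a3 n has the parity of the number of self-conjugate 3-cores of n
    (odd_card_involution). Such a 3-core is determined by its first row c: its
    cells are the (i, j) with 2i + j < c or i + 2j < c, which is proved by
    induction, deleting the first row and column
    (self_conjugate_3core_staircase). This shape is a 3-core exactly when c is
    not 2 modulo 3, and then 3n + 1 = (c + 1)^2. So there is one self-conjugate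
    3-core when 3n + 1 is a square, and none otherwise (odd_a3).

    For the count, the n <= N with 3n + 1 = k^2 correspond to the
    k <= sqrt (3N + 1) prime to 3, so with K the floor of sqrt (3N + 1) there
    are K - K / 3 of them, with Euclidean quotient (card_squares_3n1). *)

(** * A false theta identity of Rogers *)

(** Formal series in q are modelled by elements of a ring in which q is
    nilpotent: every sum is then finite, while 1 - q^(2j+1) stays invertible,
    with inverse w j. *)
Section RogersFalseTheta.
Variables (A : comNzRingType) (q : A) (w : nat -> A) (M : nat).
Hypothesis qM0 : q ^+ M = 0.
Hypothesis wV : forall j, (1 - q ^+ (2 * j + 1)) * w j = 1.

(** With x = q^(2k+1), this is sum_n (-1)^n q^(n^2-n) x^(2n) / (x; q^2)_{n+1},
    so that increasing k amounts to replacing x by x q^2. The left side of the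
    Rogers identity is the case k = 0. *)
Definition rogers_tail (k : nat) : A :=
  \sum_(n < M) (-1) ^+ n * q ^+ (n * n.+1 + 4 * k * n)
               * \prod_(j < n.+1) w (k + j)%N.

Lemma expr_nilpotent e : (M <= e)%N -> q ^+ e = 0.
Proof. by move=> leMe; rewrite -(subnK leMe) exprD qM0 mulr0. Qed.

(** One step of the Rogers-Fine transformation. Write t_n for the n-th term of
    the k-th series and s_n for the same term without its last denominator
    factor. Then s_(n+1) = - x (t_n - s_n), and the n-th term of the shifted
    series, times its prefactor, is - (1 - x) (t_(n+1) - s_(n+1)). Summing
    both relations leaves two linear equations between the sum D of the t_n,
    the sum S of the s_n and the shifted series, and S is eliminated. *)
Lemma rogers_tailS k :
  rogers_tail k =
    1 + q ^+ (2 * k + 1) - q ^+ (6 * k + 5) * rogers_tail k.+1.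
Proof.
have [M0|M_gt0] := posnP M.
  have A0 (a : A) : a = 0.
    by rewrite -[a]mulr1 -(expr0 q) expr_nilpotent ?mulr0 ?M0.
  by rewrite [LHS]A0 [RHS]A0.
set x := q ^+ (2 * k + 1).
pose W n := \prod_(j < n) w (k + j)%N.
pose c n := (-1) ^+ n * q ^+ (n * n.+1 + 4 * k * n).
pose t n := c n * W n.+1.
pose s n := c n * W n.
have WS n : (1 - x * q ^+ (2 * n)) * W n.+1 = W n.
  rewrite /W big_ord_recr /= mulrCA /x -(exprD q).
  by rewrite (_ : 2 * k + 1 + 2 * n = 2 * (k + n) + 1)%N ?wV ?mulr1 //; lia.
have cS n : c n.+1 = - (x ^+ 2 * q ^+ (2 * n)) * c n.
  have -> : c n.+1 = (-1) ^+ n.+1 * (q ^+ (n * n.+1 + 4 * k * n)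
      * ((q ^+ (2 * k + 1)) ^+ 2 * q ^+ (2 * n))).
    by rewrite /c -(exprM q) -!(exprD q); congr (_ * q ^+ _); lia.
  by rewrite exprS /c -/x; move: (q ^+ _) (q ^+ _) ((-1) ^+ n) => u v e; ring.
have xt n : x * q ^+ (2 * n) * t n = t n - s n.
  by rewrite /s -WS /t; ring.
have sS n : s n.+1 = - x * (t n - s n).
  by rewrite -xt /s cS /t; ring.
have s0 : s 0%N = 1 by rewrite /s /c /W big_ord0 muln0 !expr0 !mulr1.
have t0 : (1 - x) * t 0%N = 1.
  by rewrite -[RHS]s0 /s -WS /t muln0 expr0; ring.
have W'S n : \prod_(j < n.+1) w (k.+1 + j)%N = (1 - x) * W n.+2.
  rewrite /W [in RHS]big_ord_recl mulrA addn0 wV mul1r.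
  by apply: eq_bigr => j _; rewrite addSnnS.
have uE n : q ^+ (6 * k + 5) *
    ((-1) ^+ n * q ^+ (n * n.+1 + 4 * k.+1 * n)
      * \prod_(j < n.+1) w (k.+1 + j)%N) = - (1 - x) * (t n.+1 - s n.+1).
  rewrite W'S -xt /t cS /c.
  have -> : q ^+ (6 * k + 5) = x ^+ 3 * q ^+ 2.
    by rewrite /x -exprM -exprD; congr (q ^+ _); lia.
  have -> : q ^+ (n * n.+1 + 4 * k.+1 * n) =
      q ^+ (n * n.+1 + 4 * k * n) * q ^+ (2 * n) ^+ 2.
    by rewrite -exprM -exprD; congr (q ^+ _); lia.
  have -> : q ^+ (2 * n.+1) = q ^+ (2 * n) * q ^+ 2.
    by rewrite -exprD; congr (q ^+ _); lia.
  by ring.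
have cM : c M = 0 by rewrite /c expr_nilpotent ?mulr0 //; nia.
have shift f : f M = 0 -> \sum_(n < M) f n.+1 = \sum_(n < M) f n - f 0%N :> A.
  move=> fM; apply: (addrI (f 0%N)); rewrite addrCA subrr addr0.
  rewrite -(big_ord_recl M (fun i : 'I_M.+1 => f i)).
  by rewrite big_ord_recr /= fM addr0.
have -> : q ^+ (6 * k + 5) * rogers_tail k.+1 =
    - (1 - x) * (\sum_(n < M) t n.+1 - \sum_(n < M) s n.+1).
  rewrite /rogers_tail mulr_sumr (eq_bigr _ (fun (i : 'I_M) _ => uE i)).
  by rewrite -mulr_sumr sumrB.
rewrite (_ : rogers_tail k = \sum_(n < M) t n) //.
have tM : t M = 0 by rewrite /t cM mul0r.
have sM : s M = 0 by rewrite /s cM mul0r.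
have SE := shift s sM; rewrite (eq_bigr _ (fun (i : 'I_M) _ => sS i)) in SE.
rewrite -mulr_sumr sumrB s0 in SE; rewrite !shift // s0.
set D := \sum_(n < M) t n in SE *; set S := \sum_(n < M) s n in SE *.
have {}SE : (1 - x) * S = 1 - x * D.
  by rewrite mulrBl mul1r -[X in X - _](subrK 1) -SE; ring.
transitivity (1 + x + ((1 - x) * D - (1 - x) * t 0%N - (1 - x) * S + (1 - x))).
  by rewrite t0 SE; ring.
by ring.
Qed.

(** Iterating rogers_tailS, the prefactors q^(6k+5) for k < n multiply to
    q^(3n^2 + 2n). *)
Lemma rogers_false_theta :
  \sum_(n < M) (-1) ^+ n * q ^+ (n * n.+1) * \prod_(j < n.+1) w j =
  \sum_(n < M) (-1) ^+ n * q ^+ (3 * n ^ 2 + 2 * n) * (1 + q ^+ (2 * n + 1)).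
Proof.
have iterate K : rogers_tail 0 =
    \sum_(n < K) (-1) ^+ n * q ^+ (3 * n ^ 2 + 2 * n) * (1 + q ^+ (2 * n + 1))
    + (-1) ^+ K * q ^+ (3 * K ^ 2 + 2 * K) * rogers_tail K.
  elim: K => [|K IHK]; first by rewrite big_ord0 add0r muln0 !expr0 !mul1r.
  rewrite IHK big_ord_recr /= [in LHS]rogers_tailS -[RHS]addrA; congr (_ + _).
  have -> : q ^+ (3 * K.+1 ^ 2 + 2 * K.+1) =
      q ^+ (3 * K ^ 2 + 2 * K) * q ^+ (6 * K + 5).
    by rewrite -(exprD q); congr (q ^+ _); lia.
  by rewrite exprS; ring.
have := iterate M; rewrite (@expr_nilpotent (3 * M ^ 2 + 2 * M)); last by nia.
rewrite mulr0 mul0r addr0 => <-.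
by apply: eq_bigr => n _; rewrite muln0 mul0n addn0.
Qed.

End RogersFalseTheta.

(** * The mock theta function modulo 2 *)

(** Integer power series are studied through their images modulo x^(N+1), with
    coefficients mapped to R. These images lie in a commutative ring where x
    is nilpotent, which is the setting of the previous part. *)
Section Truncation.
Variables (R : comNzRingType) (N : nat).
Local Notation Q := {poly %/ ('X^(N.+1) : {poly R})}.
Implicit Types (p : {poly R}) (f g : fps int).

Lemma size_mk_monic_XnS : (size (mk_monic ('X^(N.+1) : {poly R}))).-1 = N.+1.
Proof. by rewrite mk_monic_Xn size_polyXn. Qed.

Lemma coef_in_qpoly_XnS p i :
  (i < N.+1)%N -> (in_qpoly 'X^(N.+1) p : Q)`_i = p`_i.
Proof.
move=> lt_i; rewrite /in_qpoly /= mk_monic_Xn.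
rewrite [p in RHS](Pdiv.RingMonic.rdivp_eq (monicXn _ N.+1)) coefD coefMXn.
by rewrite lt_i add0r.
Qed.

Lemma eq_in_qpoly_XnS p p' : (forall i, (i < N.+1)%N -> p`_i = p'`_i) ->
  in_qpoly 'X^(N.+1) p = in_qpoly 'X^(N.+1) p'.
Proof.
move=> pp'; apply/npolyP => i; have [lt_i|le_i] := ltnP i N.+1.
  by rewrite !coef_in_qpoly_XnS ?pp'.
by rewrite !big_coef_npoly // size_mk_monic_XnS.
Qed.

Definition truncate f : Q := in_qpoly 'X^(N.+1) (\poly_(i < N.+1) (f i)%:~R).

Lemma coef_truncate f i : (i < N.+1)%N -> (truncate f)`_i = (f i)%:~R.
Proof. by move=> lt_i; rewrite coef_in_qpoly_XnS // coef_poly lt_i. Qed.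

Lemma truncate_poly (p : {poly int}) :
  truncate (fps_of_poly p) = in_qpoly 'X^(N.+1) (map_poly intr p).
Proof.
by apply: eq_in_qpoly_XnS => i lt_i; rewrite coef_poly lt_i coef_map.
Qed.

Lemma truncate_mul f g : truncate (fps_mul f g) = truncate f * truncate g.
Proof.
rewrite /truncate -in_qpolyM; apply: eq_in_qpoly_XnS => i lt_i.
rewrite coef_poly lt_i coefM /fps_mul rmorph_sum; apply: eq_bigr => j _ /=.
rewrite !coef_poly (leq_ltn_trans (leq_ord j) lt_i).
by rewrite (leq_ltn_trans (leq_subr _ _) lt_i) rmorphM.
Qed.

Lemma truncate_inv f : f 0%N \is a GRing.unit ->
  truncate (fps_inv f) * truncate f = 1.
Proof.
move=> f0U; rewrite -truncate_mul -(in_qpoly1 'X^(N.+1)).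
apply: eq_in_qpoly_XnS => i lt_i; rewrite coef_poly lt_i fps_mulVf // coef1.
by case: eqP.
Qed.

Lemma truncate_sum (F : nat -> fps int) :
  (forall n m, (m < n)%N -> F n m = 0) ->
  truncate (fps_sum F) = \sum_(n < N.+1) truncate (F n).
Proof.
move=> F0; rewrite /truncate -raddf_sum; apply: eq_in_qpoly_XnS => i lt_i.
rewrite coef_poly lt_i coef_sum (fps_sumE F0 lt_i) rmorph_sum.
by apply: eq_bigr => n _; rewrite coef_poly lt_i.
Qed.

End Truncation.
Arguments truncate {R N} f.

Section Omega3Mod2.
Variable N : nat.
Local Notation Q := {poly %/ ('X^(N.+1) : {poly 'F_2})}.
Local Notation x := (in_qpoly 'X^(N.+1) 'X : Q).
Local Notation q := (x ^+ 2).

Let Q_char2 : 2%N \in [pchar Q].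
Proof. by rewrite pchar_qpoly pchar_Fp. Qed.

Lemma X_nilpotent : x ^+ N.+1 = 0.
Proof.
rewrite -rmorphXn /= -(in_qpoly0 'X^(N.+1)); apply: eq_in_qpoly_XnS => i lt_i.
by rewrite coefXn coef0 ltn_eqF.
Qed.

Lemma q_nilpotent : q ^+ N.+1 = 0.
Proof. by rewrite -exprM mulnC exprM X_nilpotent expr0n. Qed.

Definition geometric (k : nat) : Q :=
  \sum_(i < N.+1) (q ^+ (2 * k + 1)) ^+ i.

Lemma geometricP k : (1 - q ^+ (2 * k + 1)) * geometric k = 1.
Proof.
rewrite /geometric; set y := q ^+ _.
have y0 : y ^+ N.+1 = 0 by rewrite /y exprAC q_nilpotent expr0n addn1.
by rewrite -opprB mulNr -subrX1 y0 sub0r opprK.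
Qed.

(** This is where the exponent 2 disappears: over F_2 it is the Frobenius
    endomorphism, which moves x to q = x^2. *)
Lemma truncate_omega3_denom n :
  truncate (fps_of_poly (qpoch 'X 'X^2 n ^+ 2)) =
  \prod_(k < n) (1 - q ^+ (2 * k + 1)) :> Q.
Proof.
rewrite truncate_poly /qpoch !rmorphXn !rmorph_prod /= -prodrXl.
apply: eq_bigr => k _; rewrite -(pFrobenius_autE Q_char2).
rewrite !(rmorphB, rmorphM, rmorphXn, rmorph1) /= map_polyX.
by rewrite !pFrobenius_autE -expr2 -exprM -exprS addn1.
Qed.

(** The sign, which is 1 in characteristic 2, gives the term the form that it
    has in rogers_false_theta. *)
Lemma truncate_omega3_term n :
  truncate (omega3_term n) =
  (-1) ^+ n * q ^+ (n * n.+1) * \prod_(k < n.+1) geometric k.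
Proof.
rewrite (oppr_pchar2 Q_char2) expr1n mul1r /omega3_term.
rewrite truncate_mul truncate_poly map_polyXn rmorphXn /= -mulnA exprM.
congr (_ * _).
have denomU :
    fps_of_poly (qpoch 'X 'X^2 n.+1 ^+ 2 : {poly int}) 0%N \is a GRing.unit.
  by rewrite omega3_denom0 unitr1.
have := truncate_inv 'F_2 N denomU; rewrite truncate_omega3_denom => inv_denom.
have geometric_denom :
    \prod_(k < n.+1) (1 - q ^+ (2 * k + 1)) * \prod_(k < n.+1) geometric k = 1.
  by rewrite -big_split big1 //= => k _; rewrite geometricP.
by rewrite -[LHS]mulr1 -[X in _ * X = _]geometric_denom mulrA inv_denom mul1r.
Qed.

Lemma truncate_omega3 :
  truncate omega3 = in_qpoly 'X^(N.+1)
    (\sum_(n < N.+1) ('X^(2 * (3 * n ^ 2 + 2 * n))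
                      + 'X^(2 * (3 * n ^ 2 + 4 * n + 1)))) :> Q.
Proof.
rewrite (truncate_sum _ _ omega3_term_order).
rewrite (eq_bigr _ (fun (n : 'I_N.+1) _ => truncate_omega3_term n)).
rewrite (rogers_false_theta q_nilpotent geometricP) raddf_sum.
apply: eq_bigr => n _; rewrite (oppr_pchar2 Q_char2) expr1n mul1r mulrDr mulr1.
rewrite /= rmorphD !rmorphXn /= -exprD -!exprM.
by congr (_ + _ ^+ _); lia.
Qed.

End Omega3Mod2.

Lemma omega3_mod2 m : (omega3 m)%:~R =
  \sum_(n < m.+1) ((m == 2 * (3 * n ^ 2 + 2 * n))%N%:R
                   + (m == 2 * (3 * n ^ 2 + 4 * n + 1))%N%:R) :> 'F_2.
Proof.
rewrite -(coef_truncate _ _ (ltnSn m)) truncate_omega3 coef_in_qpoly_XnS //.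
by rewrite coef_sum; apply: eq_bigr => n _; rewrite coefD !coefXn.
Qed.

Lemma omega3_odd_mod2 n : (omega3 (2 * n + 1))%:~R = 0 :> 'F_2.
Proof.
rewrite omega3_mod2 big1 // => i _.
by rewrite !(introF eqP) ?addr0 //; lia.
Qed.

(** Multiplying by 3 and adding 1 completes the square in both families of
    exponents. *)
Lemma omega3_even_mod2 n : (omega3 (2 * n))%:~R =
  \sum_(i < (2 * n).+1) ((3 * n + 1 == (3 * i + 1) ^ 2)%N%:R
                         + (3 * n + 1 == (3 * i + 2) ^ 2)%N%:R) :> 'F_2.
Proof.
rewrite omega3_mod2; apply: eq_bigr => i _.
have -> : ((3 * i + 1) ^ 2 = 3 * (3 * i ^ 2 + 2 * i) + 1)%N by ring.
have -> : ((3 * i + 2) ^ 2 = 3 * (3 * i ^ 2 + 4 * i + 1) + 1)%N by ring.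
by rewrite !eqn_add2r !eqn_pmul2l.
Qed.

(** A square root k of 3n + 1 is prime to 3, and it is 3i + 1 or 3i + 2 for
    i = k / 3 only, so exactly one of the indicators is 1. *)
Lemma omega3_even_mod2_square n k : (3 * n + 1 = k ^ 2)%N ->
  (omega3 (2 * n))%:~R = 1 :> 'F_2.
Proof.
move=> nE; rewrite omega3_even_mod2.
have k3 : (k %% 3 != 0)%N.
  apply/eqP => k0; have kE := divn_eq k 3.
  by move: nE; rewrite kE k0 expnS expn1; nia.
have lt_k : (k %/ 3 < (2 * n).+1)%N.
  by have := leq_divM k 3; move: nE; rewrite expnS expn1; nia.
rewrite (bigD1 (Ordinal lt_k)) //= big1 => [|i]; rewrite nE !eqn_exp2r //.
  have [k1|k2] : (k %% 3 = 1 \/ k %% 3 = 2)%N by move: k3; clear; lia.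
    rewrite addr0 (introT eqP) ?(introF eqP) ?addr0 //; lia.
  rewrite addr0 (introF eqP) ?(introT eqP) ?add0r //; lia.
rewrite -val_eqE /= => ik.
by rewrite !(introF eqP) ?addr0 //; lia.
Qed.

Lemma omega3_even_mod2_nonsquare n : ~ (exists k, 3 * n + 1 = k ^ 2)%N ->
  (omega3 (2 * n))%:~R = 0 :> 'F_2.
Proof.
move=> nonsquare; rewrite omega3_even_mod2 big1 // => i _.
by rewrite !(introF eqP) ?addr0 // => nE; apply: nonsquare; eexists; exact: nE.
Qed.

(** * Conjugation and self-conjugate 3-cores *)

Section SelfConjugate.
Local Open Scope nat_scope.

(** The j-th row of the conjugate partition. The leg in hook_length is this
    number minus i + 1. *)
Definition conj_row (s : seq nat) (j : nat) : nat := count (fun r => j < r) s.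

(** The cells of the conjugate are the transposed cells. All facts on
    conjugation below follow from this equivalence, as a row length is
    determined by the columns that it meets (eq_from_ltn). *)
Lemma ltn_conj_row s i j : sorted geq s -> (i < conj_row s j) = (j < nth 0 s i).
Proof.
rewrite /conj_row; elim: s i => [|x s IHs] i /=; first by rewrite nth_nil ltn0.
move=> s_path; have s_sorted := path_sorted s_path.
have [lt_jx|le_xj] := ltnP j x; first by case: i => [|i] //=; rewrite -IHs.
have all_le : all (fun r => r <= j) s.
  have geq_trans : transitive geq by move=> y a b le_ya /leq_trans; apply.
  by apply: sub_all (order_path_min geq_trans s_path) => r /leq_trans; apply.
have -> : count (fun r => j < r) s = 0.
  apply/eqP; rewrite -leqn0 leqNgt -has_count -all_predC.
  by apply: sub_all all_le => r /=; rewrite -leqNgt.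
case: i => [|i] /=; first by lia.
apply/esym/negbTE; rewrite -leqNgt.
have [lt_is|le_si] := ltnP i (size s); last by rewrite nth_default.
by apply: (allP all_le); rewrite mem_nth.
Qed.

Lemma eq_from_ltn a b : (forall j, (j < a) = (j < b)) -> a = b.
Proof.
move=> ab; apply/eqP; rewrite eqn_leq [a <= b]leqNgt [b <= a]leqNgt.
by rewrite ab -[a < b]ab !ltnn.
Qed.

Lemma sum_ltn m n : m <= n -> \sum_(i < n) (i < m) = m.
Proof.
move=> le_mn; rewrite -(subnKC le_mn) big_split_ord /=.
rewrite [X in _ + X]big1 => [|i _]; last by rewrite ltnNge leq_addr.
rewrite addn0 (eq_bigr (fun=> 1)) ?sum1_card ?card_ord // => i _.
by rewrite ltn_ord.
Qed.

Lemma is_coreP t s :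
  reflect (forall i j, j < nth 0 s i -> ~~ (t %| hook_length s i j))
          (is_core t s).
Proof.
apply: (iffP forallP) => [core i j lt_j|core i].
  have lt_i : i < size s.
    by rewrite ltnNge; apply: contraL lt_j => /(nth_default 0) ->.
  by have /forallP/(_ (Ordinal lt_j)) := core (Ordinal lt_i).
by apply/forallP => j; apply: core.
Qed.

(** The i-th row of the union of the two triangles 2i + j < c and i + 2j < c,
    a shape symmetric in i and j. *)
Definition staircase_row (c i : nat) : nat := maxn (c - 2 * i) (uphalf (c - i)).

Lemma ltn_staircase_row c i j :
  (j < staircase_row c i) = (2 * i + j < c) || (i + 2 * j < c).
Proof.
by rewrite /staircase_row leq_max gtn_uphalf_double; congr (_ || _); lia.
Qed.

Lemma staircase_row_upper c i : 3 * i < c -> staircase_row c i = c - 2 * i.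
Proof. by move=> ltic; apply/maxn_idPl; rewrite leq_uphalf_double; lia. Qed.

Lemma staircase_row_lower c i : c <= 3 * i -> i <= c ->
  i + 2 * staircase_row c i = c \/ i + 2 * staircase_row c i = c.+1.
Proof.
move=> le_c le_i; rewrite /staircase_row.
rewrite (maxn_idPr _) ?geq_uphalf_double; first lia.
by have := uphalf_half (c - i); have := odd_double_half (c - i); lia.
Qed.

Lemma staircase_row_ge c i : c <= i -> staircase_row c i = 0.
Proof.
by move=> le_ci; apply/eqP; rewrite -leqn0 leqNgt ltn_staircase_row; lia.
Qed.

(** Deleting the first row and column of the staircase for c + 3 leaves the one
    for c; the boolean accounts for the cell of the first column. *)
Lemma staircase_rowS c i :
  staircase_row (c + 3) i.+1 = staircase_row c i + (i < c + 2).
Proof.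
have [h|h] := ltnP i (c + 2); apply: eq_from_ltn => j; rewrite ?addn0 ?addn1.
  by case: j => [|j]; rewrite ?ltnS !ltn_staircase_row; lia.
by rewrite !ltn_staircase_row; lia.
Qed.

(** The staircase is symmetric, so this is its hook length at (i, j). Among the
    rows with 3i < c the hooks are 2c - 1 modulo 3; between such a row and a
    lower one they are 1 or 2 modulo 3; two lower rows share no cell. *)
Lemma staircase_row_hook c i j : c %% 3 != 2 -> j < staircase_row c i ->
  ~~ (3 %| staircase_row c i + staircase_row c j - i - j - 1).
Proof.
move=> c3; rewrite ltn_staircase_row => cell.
have [upi|loi] := ltnP (3 * i) c; have [upj|loj] := ltnP (3 * j) c.
- by rewrite !staircase_row_upper //; lia.
- by rewrite staircase_row_upper //; have := @staircase_row_lower c j; lia.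
- rewrite (@staircase_row_upper c j) //.
  by have := @staircase_row_lower c i; lia.
- by lia.
Qed.

(** The first row and column have 2c - 1 cells together, and
    (c + 1)^2 = (c - 2)^2 + 3 (2c - 1). *)
Lemma sum_staircase_row c m : c %% 3 != 2 -> c <= m ->
  3 * (\sum_(i < m) staircase_row c i) + 1 = c.+1 ^ 2.
Proof.
elim/ltn_ind: c m => c IHc m c3 le_cm.
have [lt_c3|le_3c] := ltnP c 3.
  have c01 : (c == 0) || (c == 1) by move: c3 lt_c3; clear; lia.
  case: m le_cm => [|m] le_cm.
    by case/orP: c01 le_cm => /eqP ->; rewrite ?big_ord0.
  rewrite big_ord_recl big1 => [|i _]; last first.
    by rewrite staircase_row_ge //= /bump; lia.
  by case/orP: c01 => /eqP ->.
case: m le_cm => [|m] le_cm; first by lia.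
rewrite big_ord_recl /=.
have row_succ i : staircase_row c i.+1 = staircase_row (c - 3) i + (i < c.-1).
  by rewrite -{1}(subnK le_3c) staircase_rowS (_ : c - 3 + 2 = c.-1) //; lia.
rewrite (eq_bigr _ (fun (i : 'I_m) _ => row_succ i)) big_split /=.
rewrite sum_ltn; last lia.
have : 3 * (\sum_(i < m) staircase_row (c - 3) i) + 1 = (c - 3).+1 ^ 2.
  by apply: IHc; lia.
rewrite staircase_row_upper; last lia; move: (\sum_(i < m) _) => S; nia.
Qed.

(** Here f i is the length of row i, f_sym says that the partition is
    self-conjugate (it also forces f to be decreasing), and the number in
    f_core is then the hook length. Deleting the first row and column keeps the
    hook lengths of the other cells, so by induction the rest g is a staircase,
    of first row c' = g 0 with c' not 2 modulo 3. For c > 1, the hooks at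
    (0, 0) and (0, 1) then force c = c' modulo 3, and c > c' + 3 would leave a
    hook of length 3 in the first row, so c = c' + 3. *)
Lemma self_conjugate_3core_staircase (f : nat -> nat) :
  (forall i j, (j < f i) = (i < f j)) ->
  (forall i j, j < f i -> ~~ (3 %| f i + f j - i - j - 1)) ->
  f 0 %% 3 != 2 /\ f =1 staircase_row (f 0).
Proof.
move: {2}(f 0) (erefl (f 0)) => c; elim/ltn_ind: c f => c IHc f f0 f_sym f_core.
have f_pos i : (0 < f i) = (i < c) by rewrite f_sym f0.
have [c0|c_gt0] := posnP c.
  rewrite f0 c0; split=> // i; rewrite staircase_row_ge //.
  by have := f_pos i; rewrite c0 ltn0; case: (f i).
have le_f10 : f 1 <= c.
  rewrite leqNgt -f0; apply/negP; rewrite f_sym => /ltnW.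
  by rewrite -f_sym ltnn.
pose g i := (f i.+1).-1.
have g_sym i j : (j < g i) = (i < g j).
  by rewrite /g !ltn_predRL f_sym.
have g_core i j : j < g i -> ~~ (3 %| g i + g j - i - j - 1).
  move=> lt_j; have lt_i := lt_j; rewrite g_sym in lt_i.
  have lt_j1 : j.+1 < f i.+1 by move: lt_j; rewrite /g ltn_predRL.
  by have := f_core _ _ lt_j1; move: lt_j lt_i; rewrite /g; clear; lia.
have lt_g0 : g 0 < c by move: le_f10 c_gt0; rewrite /g; clear; lia.
have [c'3 gE] := IHc _ lt_g0 g erefl g_sym g_core.
have := f_core 0 0; rewrite f0 => /(_ c_gt0) hook00.
have c3 : c %% 3 != 2 by move: hook00; clear; lia.
split=> // i.
have [c1|c_gt1] := eqVneq c 1.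
  case: i => [|i]; first by rewrite f0 c1.
  rewrite staircase_row_ge ?c1 //.
  by have := f_pos i.+1; rewrite c1; case: (f i.+1).
have {c_gt1} gt_c1 : 1 < c by move: c_gt1 c_gt0; clear; lia.
have := f_core 0 1; rewrite f0 => /(_ gt_c1) hook01.
have f1E : f 1 = (g 0).+1 by rewrite /g prednK // f_pos.
have c_le : c <= g 0 + 3.
  (* Otherwise row c - 3 is 1, and the hook at (0, c - 3) has length 3. *)
  rewrite leqNgt; apply/negP => gt_c.
  have lt_c : c - 3 < c by move: c_gt0; clear; lia.
  have := f_core 0 (c - 3); rewrite f0 => /(_ lt_c).
  have : g (c - 4) = 0.
    by rewrite gE staircase_row_ge //; move: gt_c; clear; lia.
  rewrite /g (_ : (c - 4).+1 = c - 3); last by move: gt_c; clear; lia.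
  by have := f_pos (c - 3); move: gt_c lt_c; clear; lia.
have cE : c = g 0 + 3.
  by move: c3 c'3 hook01 c_le lt_g0; rewrite f1E; clear; lia.
case: i => [|i]; first by rewrite f0 staircase_row_upper // muln0 subn0.
have fi_pos : (0 < f i.+1) = (i < g 0 + 2) by rewrite f_pos cE addnS ltnS.
rewrite cE staircase_rowS -gE {1}/g -fi_pos; case: (f i.+1) => //= m.
by rewrite addn1.
Qed.
End SelfConjugate.

Section ConjugateCores.
Local Open Scope nat_scope.

(** The points moved by the involution come in pairs {x, f x}. *)
Lemma odd_card_involution (T : finType) (f : T -> T) (A : {set T}) :
  {in A, involutive f} -> {in A, forall x, f x \in A} ->
  odd #|A| = odd #|[set x in A | f x == x]|.
Proof.
move: {2}(#|A|) (erefl #|A|) => m; elim/ltn_ind: m A => m IHm A cardA fK fA.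
have [x /andP[xA fxx]|fix_all] := pickP [pred x in A | f x != x]; last first.
  congr (odd #|pred_of_set _|); apply/setP => x; rewrite inE.
  by have := fix_all x; rewrite /=; case: (x \in A) => //= /negbFE ->.
set B := A :\ x :\ f x.
have fxA : f x \in A :\ x by rewrite in_setD1 fxx fA.
have cardB : #|A| = #|B|.+2.
  by rewrite (cardsD1 x) xA (cardsD1 (f x) (A :\ x)) fxA.
have BA y : y \in B -> y \in A by rewrite !in_setD1 => /and3P[].
rewrite cardB /= negbK (IHm #|B|) //; last 3 first.
- by rewrite -cardA cardB.
- by move=> y /BA /fK.
- move=> y; rewrite !in_setD1 => /and3P[y_fx yx yA].
  rewrite fA // andbT; apply/andP; split.
    by apply: contraNneq yx => fy; rewrite -(fK y) // fy fK.
  by apply: contraNneq y_fx => <-; rewrite fK.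
congr (odd #|pred_of_set _|); apply/setP => y; rewrite !inE.
have [->|yx] := eqVneq y x; first by rewrite (negbTE fxx) !andbF.
have [->|//] := eqVneq y (f x).
by rewrite fK // eq_sym (negbTE fxx) !andbF.
Qed.

Variable n : nat.
Implicit Type p : n.-tuple 'I_n.+1.

Definition rows p : seq nat := map (@nat_of_ord n.+1) p.
(** Lossless as long as f is bounded by n and vanishes from n on
    (nth_tuple_of_rows). *)
Definition tuple_of_rows (f : nat -> nat) : n.-tuple 'I_n.+1 :=
  [tuple inord (f i) | i < n].
Definition conjugate p := tuple_of_rows (conj_row (rows p)).

Lemma size_rows p : size (rows p) = n.
Proof. by rewrite size_map size_tuple. Qed.

Lemma nth_rows_le p i : nth 0 (rows p) i <= n.
Proof.
have [lt_in|le_ni] := ltnP i (size (rows p)); last by rewrite nth_default.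
rewrite size_map in lt_in; rewrite (nth_map ord0) //.
exact: leq_ord.
Qed.

Lemma nth_tuple_of_rows f i : f i <= n -> (n <= i -> f i = 0) ->
  nth 0 (rows (tuple_of_rows f)) i = f i.
Proof.
move=> le_fi f0; have [lt_in|le_ni] := ltnP i n; last first.
  by rewrite nth_default ?size_rows // f0.
rewrite (nth_map ord0) ?size_tuple // -[i]/(val (Ordinal lt_in)).
by rewrite -tnth_nth tnth_mktuple inordK.
Qed.

Lemma nth_rows_inj p p' :
  nth 0 (rows p) =1 nth 0 (rows p') -> p = p'.
Proof.
move=> pp'; apply/val_inj/(inj_map (@ord_inj n.+1)).
by apply: (@eq_from_nth _ 0) => [|i _]; rewrite ?size_map ?size_tuple // pp'.
Qed.

Lemma sumn_rows p : sumn (rows p) = \sum_(i < n) nth 0 (rows p) i.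
Proof. by rewrite sumnE (big_nth 0) size_rows big_mkord. Qed.

Lemma nth_conjugate p j : nth 0 (rows (conjugate p)) j = conj_row (rows p) j.
Proof.
apply: nth_tuple_of_rows => [|le_nj].
  by apply: leq_trans (count_size _ _) _; rewrite size_rows.
apply/eqP; rewrite -leqn0 leqNgt -has_count; apply/negP => /hasP[r r_p lt_jr].
have := nth_rows_le p (index r (rows p)); rewrite nth_index //.
by rewrite leqNgt (leq_trans _ lt_jr).
Qed.

Lemma sorted_conjugate p : sorted geq (rows (conjugate p)).
Proof.
apply/(sortedP 0) => i _; rewrite !nth_conjugate /=.
by apply: sub_count => r /=; apply: ltnW.
Qed.

Lemma conj_row_conjugate p i : sorted geq (rows p) ->
  conj_row (rows (conjugate p)) i = nth 0 (rows p) i.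
Proof.
move=> p_sorted; apply: eq_from_ltn => j.
by rewrite (ltn_conj_row _ _ (sorted_conjugate p)) nth_conjugate ltn_conj_row.
Qed.

Lemma conjugateK p : sorted geq (rows p) -> conjugate (conjugate p) = p.
Proof.
move=> p_sorted; apply: nth_rows_inj => i.
by rewrite nth_conjugate conj_row_conjugate.
Qed.

(** Both sides count the cells, by columns and by rows. *)
Lemma sumn_conjugate p : sumn (rows (conjugate p)) = sumn (rows p).
Proof.
rewrite sumn_rows (eq_bigr (fun j : 'I_n => \sum_(r <- rows p) (j < r))).
  rewrite exchange_big sumnE; apply: eq_big_seq => r r_p /=.
  by rewrite sum_ltn // -(nth_index 0 r_p) nth_rows_le.
by move=> j _; rewrite nth_conjugate /conj_row -sum1_count big_mkcond.
Qed.

Lemma mem_cores t p : (p \in cores t n) =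
  [&& sorted geq (rows p), sumn (rows p) == n & is_core t (rows p)].
Proof. by rewrite inE. Qed.

(** The hook of (i, j) in the conjugate is the hook of (j, i), with arm and leg
    exchanged. *)
Lemma conjugate_core t p : p \in cores t n -> conjugate p \in cores t n.
Proof.
rewrite !mem_cores => /and3P[p_sorted p_sum /is_coreP p_core].
rewrite sorted_conjugate sumn_conjugate p_sum /=; apply/is_coreP => i j.
rewrite nth_conjugate ltn_conj_row // => /p_core.
rewrite /hook_length -!/(conj_row _ _) conj_row_conjugate // nth_conjugate.
by rewrite addnC.
Qed.

Definition self_conjugate_cores t : {set n.-tuple 'I_n.+1} :=
  [set p in cores t n | conjugate p == p].

Lemma self_conjugate_3core_rows p : p \in self_conjugate_cores 3 ->
  exists2 c, 3 * n + 1 = c.+1 ^ 2 & nth 0 (rows p) =1 staircase_row c.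
Proof.
rewrite inE mem_cores => /andP[/and3P[p_sorted /eqP p_sum /is_coreP p_core]].
move=> /eqP p_conj; pose f := nth 0 (rows p).
have conjE j : conj_row (rows p) j = f j by rewrite -nth_conjugate p_conj.
have f_sym i j : (j < f i) = (i < f j) by rewrite -ltn_conj_row // conjE.
have f_core i j : j < f i -> ~~ (3 %| f i + f j - i - j - 1).
  move=> lt_j; have := p_core _ _ lt_j; rewrite /hook_length -/(conj_row _ _).
  by rewrite conjE -/(f i); have := lt_j; rewrite f_sym in lt_j; lia.
have [c3 fE] := self_conjugate_3core_staircase f_sym f_core.
exists (f 0) => //; rewrite -(sum_staircase_row c3 (nth_rows_le p 0)).
by rewrite -{1}p_sum sumn_rows; under eq_bigr do rewrite -/(f _) fE.
Qed.

(** As (c + 1)^2 is not divisible by 3, c is not 2 modulo 3. *)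
Lemma self_conjugate_3core_exists c : 3 * n + 1 = c.+1 ^ 2 ->
  tuple_of_rows (staircase_row c) \in self_conjugate_cores 3.
Proof.
move=> nE; have le_cn : c <= n by move: nE; rewrite expnS expn1; nia.
have c3 : c %% 3 != 2.
  apply/negP => /eqP c2; have cE := divn_eq c 3; rewrite c2 in cE.
  by move: nE; rewrite cE expnS expn1; nia.
set p := tuple_of_rows _.
have rowE i : nth 0 (rows p) i = staircase_row c i.
  apply: nth_tuple_of_rows => [|le_ni]; last first.
    by rewrite staircase_row_ge // (leq_trans le_cn).
  by rewrite leqNgt ltn_staircase_row; move: le_cn; clear; lia.
have p_sorted : sorted geq (rows p).
  apply/(sortedP 0) => i _; rewrite !rowE /= leqNgt ltn_staircase_row.
  have : ~~ (staircase_row c i < staircase_row c i) by rewrite ltnn.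
  by rewrite ltn_staircase_row; lia.
have conjE j : conj_row (rows p) j = staircase_row c j.
  apply: eq_from_ltn => i.
  by rewrite ltn_conj_row // rowE !ltn_staircase_row; lia.
rewrite inE mem_cores p_sorted; apply/andP; split; last first.
  by apply/eqP/nth_rows_inj => i; rewrite nth_conjugate conjE rowE.
apply/and3P; split=> //.
  rewrite sumn_rows (eq_bigr (fun i : 'I_n => staircase_row c i)) => [|i _ //].
  by have /eqP := sum_staircase_row c3 le_cn; rewrite -nE eqn_add2r eqn_pmul2l.
apply/is_coreP => i j; rewrite rowE => cell.
rewrite /hook_length -/(conj_row _ _) conjE rowE.
have := staircase_row_hook c3 cell; have := cell.
rewrite ltn_staircase_row orbC.
have -> : (i + 2 * j < c) || (2 * i + j < c) = (i < staircase_row c j).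
  by rewrite ltn_staircase_row; lia.
lia.
Qed.

(** The equation 3n + 1 = (c + 1)^2 determines c, hence the rows of the only
    possible self-conjugate 3-core of n. *)
Lemma odd_a3 : odd (a3 n) <-> exists k, 3 * n + 1 = k ^ 2.
Proof.
rewrite /a3 (@odd_card_involution _ conjugate); first last.
- by move=> p; apply: conjugate_core.
- by move=> p; rewrite mem_cores => /and3P[/conjugateK].
rewrite -/(self_conjugate_cores 3); split=> [odd_card|[k nE]].
  have /set0Pn[p /self_conjugate_3core_rows[c nE _]] :
      self_conjugate_cores 3 != set0.
    by apply: contraTneq odd_card => ->; rewrite cards0.
  by exists c.+1.
have [c kE] : exists c, k = c.+1.
  by case: k nE => [|c _]; [rewrite exp0n // addn1 | exists c].
rewrite {k}kE in nE; have pc := self_conjugate_3core_exists nE.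
rewrite (_ : self_conjugate_cores 3 = [set tuple_of_rows (staircase_row c)]);
  first by rewrite cards1.
apply/eqP; rewrite eqEsubset sub1set pc andbT.
have unique c' : 3 * n + 1 = c'.+1 ^ 2 -> c' = c.
  by move=> nE'; apply/succn_inj/eqP; rewrite -(@eqn_exp2r _ _ 2) // -nE' nE.
have [_ /unique -> rowE] := self_conjugate_3core_rows pc.
apply/subsetP => p /self_conjugate_3core_rows[_ /unique -> pE].
by rewrite inE; apply/eqP/nth_rows_inj => i; rewrite pE rowE.
Qed.

End ConjugateCores.

(** * Counting the squares among the numbers 3n + 1 *)

Section CountSquares.
Local Open Scope nat_scope.

Lemma card_non_multiples_of_3 K :
  #|[set k : 'I_K.+1 | ~~ (3 %| k)]| = K - K %/ 3.
Proof.
rewrite -sum1dep_card big_mkcond /=.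
elim: K => [|K IHK]; first by rewrite big_ord_recl big_ord0.
by rewrite big_ord_recr /= IHK; case: ifP; lia.
Qed.

(** The bijection sends n to the root k of 3n + 1; its inverse sends a k prime
    to 3 to (k^2 - 1) / 3. *)
Lemma card_squares_3n1 N K : K ^ 2 <= 3 * N + 1 < K.+1 ^ 2 ->
  #|[set n : 'I_N.+1 | [exists k : 'I_K.+1, k ^ 2 == 3 * n + 1]]| = K - K %/ 3.
Proof.
move=> /andP[leK ltK]; rewrite -card_non_multiples_of_3.
pose f (k : 'I_K.+1) : 'I_N.+1 := inord ((k ^ 2).-1 %/ 3).
have fE (k : 'I_K.+1) : ~~ (3 %| k) -> k ^ 2 = 3 * f k + 1.
  move=> k3; have le_kK : k ^ 2 <= K ^ 2 by rewrite leq_exp2r // leq_ord.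
  have kE : k ^ 2 = 3 * ((k ^ 2).-1 %/ 3) + 1.
    have := divn_eq k 3; have : k %% 3 < 3 by rewrite ltn_mod.
    move: k3; rewrite /dvdn; case: (k %% 3) => [|[|[|r]]] // _ _ ->.
      by rewrite expnS expn1; nia.
    by rewrite expnS expn1; nia.
  by rewrite /f inordK // ltnS; lia.
rewrite -(card_in_imset (f := f)); last first.
  move=> k k'; rewrite !inE => k3 k'3 ff; apply/val_inj/eqP.
  by rewrite /= -(@eqn_exp2r _ _ 2) // fE // ff -fE.
congr #|pred_of_set _|; apply/setP => n; rewrite inE.
apply/existsP/imsetP => [[k /eqP kE]|[k]]; last first.
  by rewrite inE => k3 ->; exists k; rewrite fE.
exists k.
  rewrite inE; apply/negP => /dvdnP[m km]; move: kE.
  by rewrite km expnS expn1; nia.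
by apply/val_inj; rewrite /= /f kE addn1 /= mulKn // inordK.
Qed.

End CountSquares.

(** The second floor is the Euclidean quotient because no integer multiple of 3
    lies strictly between K and sqrt m < K + 1. *)
Lemma floor_sqrt (R : realType) (m : nat) :
  exists2 K : nat, (K ^ 2 <= m < K.+1 ^ 2)%N &
    Num.floor (Num.sqrt m%:R : R) = K%:Z /\
    Num.floor (Num.sqrt m%:R / 3%:R : R) = (K %/ 3)%N%:Z.
Proof.
have [K Km] : exists K : nat, (K ^ 2 <= m < K.+1 ^ 2)%N.
  have ex : exists K : nat, (K ^ 2 <= m)%N by exists 0%N.
  have ub K : (K ^ 2 <= m)%N -> (K <= m)%N by rewrite expnS expn1; nia.
  have [K leK maxK] := ex_maxnP ex ub; exists K; rewrite leK /= ltnNge.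
  by apply/negP => /maxK; rewrite ltnn.
exists K => //; have /andP[leK ltK] := Km.
have le_sqrt : (K%:R : R) <= Num.sqrt m%:R.
  by rewrite -[K%:R]ger0_norm // -sqrtr_sqr ler_wsqrtr // -natrX ler_nat.
have lt_sqrt : Num.sqrt m%:R < (K.+1%:R : R).
  rewrite -[K.+1%:R]ger0_norm // -sqrtr_sqr ltr_sqrt -natrX ?ltr_nat //.
have intS n : (n%:Z + 1)%:~R = n.+1%:R :> R by rewrite intrD natr1.
split; apply/floor_def; rewrite intS.
  by rewrite le_sqrt lt_sqrt.
rewrite -pmulrn ler_pdivlMr ?ltr_pdivrMr // -!natrM; apply/andP; split.
  by apply: le_trans le_sqrt; rewrite ler_nat leq_divM.
by apply: lt_le_trans lt_sqrt _; rewrite ler_nat; lia.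
Qed.

(** * Assembling the congruences *)

Lemma eqz_mod2 (a b : int) : (a = b %[mod 2])%Z <-> a%:~R = b%:~R :> 'F_2.
Proof.
rewrite (rwP eqP) eqz_mod_dvd (dvdz_pcharf (pchar_Fp (isT : prime 2))).
by rewrite intrB subr_eq0 -(rwP eqP).
Qed.

Lemma natr_F2 n : n%:R = (odd n)%:R :> 'F_2.
Proof.
have char2 := pchar_Fp (isT : prime 2).
rewrite -[in LHS](odd_double_half n) natrD -muln2 natrM (pcharf0 char2).
by rewrite mulr0 addr0.
Qed.

Lemma omega3_even_mod2_cores n :
  (omega3 (2 * n))%:~R = (odd (a3 n))%:R :> 'F_2.
Proof.
have [a3_odd|a3_even] := boolP (odd (a3 n)).
  by have [k kE] := (odd_a3 n).1 a3_odd; rewrite (omega3_even_mod2_square kE).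
rewrite omega3_even_mod2_nonsquare // => /(odd_a3 n).2.
by apply/negP.
Qed.

Lemma omega3_even_odd_iff_square n :
  (omega3 (2 * n)%N = 1 %[mod 2])%Z <-> exists k, (3 * n + 1 = k ^ 2)%N.
Proof.
rewrite eqz_mod2 omega3_even_mod2_cores -odd_a3.
by case: odd; split.
Qed.

Theorem theorem4p4 (R : realType) :
  (forall n : nat,
     (omega3 (2 * n + 1)%N = 0 %[mod 2])%Z /\
     (omega3 (2 * n)%N = (a3 n)%:Z %[mod 2])%Z) /\
  (forall n : nat,
     (omega3 (2 * n)%N = 1 %[mod 2])%Z <->
     exists k : int, (3 * n + 1)%N%:Z = k ^+ 2) /\
  (forall N : nat,
     (#|[set n : 'I_N.+1 | (omega3 (2 * n)%N == 1 %[mod 2])%Z]|)%:Z =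
     Num.floor (Num.sqrt (3 * N + 1)%:R : R) -
     Num.floor (Num.sqrt (3 * N + 1)%:R / 3%:R : R)).
Proof.
split=> [n|]; first split.
- by apply/eqz_mod2; rewrite omega3_odd_mod2.
- by apply/eqz_mod2; rewrite omega3_even_mod2_cores -pmulrn [RHS]natr_F2.
split=> [n|N].
  rewrite omega3_even_odd_iff_square; split=> [[k ->]|[k kE]].
    by exists k%:Z; rewrite -[LHS]natz natrX natz.
  by exists `|k|%N; have := congr1 absz kE; rewrite abszX.
have [K Km [-> ->]] := floor_sqrt R (3 * N + 1).
rewrite subzn ?leq_div // -(card_squares_3n1 Km); congr (Posz #|pred_of_set _|).
apply/setP => n; rewrite !inE; apply/eqP/existsP.
  move=> /omega3_even_odd_iff_square[k kE]; have /andP[_ ltK] := Km.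
  have lt_kK : (k < K.+1)%N.
    rewrite -(@ltn_exp2r _ _ 2) // -kE (leq_ltn_trans _ ltK) //.
    by have := leq_ord n; lia.
  by exists (Ordinal lt_kK); rewrite kE.
by move=> [k /eqP kE]; apply/omega3_even_odd_iff_square; exists k.
Qed.
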